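(* Let $\Lambda$ be the Poisson algebra described in the context: the free polynomial (associative) algebra generated by $C^\infty(\mathbb{R}^s)$ and the momenta $p_1,\dots,p_s$, with the canonical Lie product extended to it exclusively through linearity, antisymmetry and the Leibniz rule. Then $\Lambda$ contains a central variable $Z$ such that, for all $A,B\in\Lambda$, $$[A,B]\equiv AB-BA=Z\,\{A,B\},\qquad \{Z,A\}=0=[Z,A];$$ in particular $$[q_i,p_j]=Z\{q_i,p_j\}=Z\,\delta_{ij},\qquad Z=-Z^*,$$ $$[q_i,q_j]=Z\{q_i,q_j\}=0,\qquad [p_i,p_j]=Z\{p_i,p_j\}=0,$$ for $i,j=1,\dots,s$.
   Context: A Poisson algebra is an associative algebra, not assumed commutative (so that the associative product defines the commutator $[A,B]\equiv AB-BA$), which is also equipped with a Lie product $\{\cdot,\cdot\}$, i.e. a product which is linear in both factors, antisymmetric, satisfies the Jacobi identity, and satisfies the Leibniz rule with respect to the associative product, $\{A,BC\}=\{A,B\}C+B\{A,C\}$. No relation between the commutator and the Lie product is assumed. $C^\infty(\mathbb{R}^s)$ is the associative (commutative) algebra of infinitely differentiable functions $f(q)$ of the coordinates $q=(q_1,\dots,q_s)$, and $p_1,\dots,p_s$ are the momenta. $\Lambda$ is the free polynomial (associative) algebra generated by the associative algebra $C^\infty(\mathbb{R}^s)$ and by the $p_j$. The canonical Lie product $$\{f(q),p_i\}=\partial f/\partial q_i,\qquad \{f(q),g(q)\}=0=\{p_i,p_j\}$$ is extended to $\Lambda$ exclusively through linearity, antisymmetry and the Leibniz rule; with it $\Lambda$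 is a Poisson algebra. The symbol $*$ denotes the unique involution (adjoint operation) on $\Lambda$ which leaves the canonical variables $q_i,p_i$ invariant and satisfies $\{A^*,B^*\}=\{A,B\}^*$.
   Formalization: Since the Leibniz rule is inconsistent on the literally free algebra (it forces 2qpq = q²p + pq²), Λ is read as the universal algebra generated by real C^∞(R^s) and the p_j modulo the relations forced by linearity, antisymmetry, Leibniz and the canonical Lie products. *)

(* Defs.v *)
From HB Require Import structures.
From mathcomp Require Import all_boot all_order all_algebra generic_quotient.
From mathcomp Require Import all_classical all_reals all_analysis.
From mathcomp Require Import ring.
Set Implicit Arguments.
Unset Strict Implicit.
Unset Printing Implicit Defensive.
Import Order.TTheory GRing.Theory Num.Theory.
Import numFieldNormedType.Exports.
Local Open Scope classical_set_scope.
Local Open Scope ring_scope.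
Local Open Scope quotient_scope.

Section Smooth.
Variables (R : realType) (s : nat).
Local Notation V := 'rV[R]_s.

Definition partial_fun (i : 'I_s) (f : V -> R) : V -> R :=
  fun x => 'D_(delta_mx 0 i) f x.

(* C^k: all iterated partial derivatives of order at most k exist and are
   continuous *)
Fixpoint classC (k : nat) (f : V -> R) : Prop :=
  if k is k'.+1 then
    continuous f /\
    forall i : 'I_s, (forall x, derivable f x (delta_mx 0 i)) /\
                     classC k' (partial_fun i f)
  else continuous f.

Definition smooth : {pred V -> R} := fun f => `[< forall k, classC k f >].

Lemma classC_cont k f : classC k f -> continuous f.
Proof. by case: k => [|k] // []. Qed.

Lemma classCW k f : classC k.+1 f -> classC k f.
Proof.
elim: k f => [|k IH] f; first by case.
move=> [cf hf]; split=> // i; have [df pf] := hf i; split=> //; exact: IH.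
Qed.

Lemma classC_cst k (c : R) : classC k (cst c).
Proof.
elim: k c => [|k IH] c /=; first exact: cst_continuous.
split; first exact: cst_continuous.
move=> i; split; first by move=> x; exact: derivable_cst.
suff -> : partial_fun i (cst c) = cst 0 by apply: IH.
by apply/funext => x; rewrite /partial_fun derive_cst.
Qed.

Lemma partial_funD i (f g : V -> R) : (forall x, derivable f x (delta_mx 0 i)) ->
  (forall x, derivable g x (delta_mx 0 i)) ->
  partial_fun i (f + g) = partial_fun i f + partial_fun i g.
Proof. by move=> df dg; apply/funext => x; rewrite /partial_fun deriveD. Qed.

Lemma partial_funM i (f g : V -> R) : (forall x, derivable f x (delta_mx 0 i)) ->
  (forall x, derivable g x (delta_mx 0 i)) ->
  partial_fun i (f * g) = partial_fun i f * g + f * partial_fun i g.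
Proof.
move=> df dg; apply/funext => x; rewrite /partial_fun deriveM //=.
by rewrite addrC; congr (_ + _); rewrite /GRing.scale /= mulrC.
Qed.

Lemma classCD k (f g : V -> R) : classC k f -> classC k g -> classC k (f + g).
Proof.
elim: k f g => [|k IH] f g.
  by move=> cf cg x; apply: continuousD; [exact: cf|exact: cg].
move=> [cf hf] [cg hg]; split.
  by move=> x; apply: continuousD; [exact: cf|exact: cg].
move=> i; have [df pf] := hf i; have [dg pg] := hg i; split.
  by move=> x; apply: derivableD.
by rewrite partial_funD //; apply: IH.
Qed.

Lemma classCM k (f g : V -> R) : classC k f -> classC k g -> classC k (f * g).
Proof.
elim: k f g => [|k IH] f g.
  by move=> cf cg x; apply: continuousM; [exact: cf|exact: cg].
move=> Cf Cg; have [cf hf] := Cf; have [cg hg] := Cg; split.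
  by move=> x; apply: continuousM; [exact: cf|exact: cg].
move=> i; have [df pf] := hf i; have [dg pg] := hg i; split.
  by move=> x; apply: derivableM.
by rewrite partial_funM //; apply: classCD; apply: IH => //; apply: classCW.
Qed.

Lemma smooth_cst c : cst c \in smooth.
Proof. by apply/asboolP => k; exact: classC_cst. Qed.

Lemma smoothD (f g : V -> R) : f \in smooth -> g \in smooth -> f + g \in smooth.
Proof. by move=> /asboolP hf /asboolP hg; apply/asboolP => k; exact: classCD. Qed.

Lemma smoothM (f g : V -> R) : f \in smooth -> g \in smooth -> f * g \in smooth.
Proof. by move=> /asboolP hf /asboolP hg; apply/asboolP => k; exact: classCM. Qed.

Lemma smoothZ (c : R) (f : V -> R) : f \in smooth -> c *: f \in smooth.
Proof.
have -> : c *: f = cst c * f by apply/funext.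
by apply: smoothM; exact: smooth_cst.
Qed.

Lemma smooth_derivable f i x : f \in smooth -> derivable f x (delta_mx 0 i).
Proof. by move=> /asboolP /(_ 1%N) [_ /(_ i)[]]. Qed.

Lemma smooth_partial i f : f \in smooth -> partial_fun i f \in smooth.
Proof. by move=> /asboolP hf; apply/asboolP => k; have [_ /(_ i)[]] := hf k.+1. Qed.

Lemma is_derive_coord (i : 'I_s) (x v : V) :
  is_derive x v (fun y : V => y 0 i : R) (v 0 i).
Proof.
have E : (fun h : R => h^-1 *: (((fun y : V => y 0 i : R) \o shift x) (h *: v) - x 0 i))
   @ 0^' --> v 0 i.
  apply: (@cvg_trans _ ((cst (v 0 i)) @ (0:R)^')); last exact: cvg_cst.
  apply: near_eq_cvg; near=> h => /=.
  rewrite !mxE addrK /GRing.scale /= mulrA mulVf ?mul1r //.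
  by near: h; exact: nbhs_dnbhs_neq.
by split; [apply: cvgP E | exact: cvg_lim E].
Unshelve. all: by end_near.
Qed.

Lemma smooth_coord (i : 'I_s) : (fun x : V => x 0 i : R) \in smooth.
Proof.
apply/asboolP => -[|k] /=; first by move=> x; exact: coord_continuous.
split; first by move=> x; exact: coord_continuous.
move=> j; split; first by move=> x; exact: (@ex_derive _ _ _ _ _ _ _ (is_derive_coord i x _)).
suff -> : partial_fun j (fun x : V => x 0 i : R) = cst ((delta_mx 0 j : V) 0 i).
  exact: classC_cst.
by apply/funext => x; rewrite /partial_fun (@derive_val _ _ _ _ _ _ _ (is_derive_coord i x _)).
Qed.

Lemma is_derive_line (f : V -> R) (x v : V) (t : R) :
  derivable f (x + t *: v) v ->
  is_derive t 1 (fun u : R => f (x + u *: v)) ('D_v f (x + t *: v)).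
Proof.
move=> df.
have E : (fun h : R => h^-1 *: (((fun u : R => f (x + u *: v)) \o shift t) (h *: 1)
             - f (x + t *: v)))
       = (fun h : R => h^-1 *: ((f \o shift (x + t *: v)) (h *: v) - f (x + t *: v))).
  apply/funext => h /=; congr (_ *: (f _ - _)).
  by rewrite [h *: 1]mulr1 scalerDl addrCA.
by split; rewrite /derivable /derive /= E.
Qed.

Lemma second_difference (f : V -> R) (x v w : V) (h : R) : 0 < h ->
  (forall y, derivable f y v) -> (forall y, derivable ('D_v f) y w) ->
  exists a b : R, [/\ 0 <= a <= h, 0 <= b <= h &
    f (x + h *: w + h *: v) - f (x + h *: v) - (f (x + h *: w) - f x)
    = 'D_w ('D_v f) (x + a *: v + b *: w) * h * h].
Proof.
move=> h0 dv dw.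
pose phi (t : R) := f (x + h *: w + t *: v) - f (x + t *: v).
pose dphi (t : R) := 'D_v f (x + h *: w + t *: v) - 'D_v f (x + t *: v).
have dphiP (t : R) : is_derive t (1 : R) phi (dphi t).
  by apply: is_deriveB; apply: is_derive_line.
have cphi : {within `[0, h], continuous phi}.
  apply: derivable_within_continuous => t _.
  exact: (@ex_derive _ _ _ _ _ _ _ (dphiP t)).
have [a /[!in_itv]/= /andP[a0 ah] Ea] := MVT h0 (fun t _ => dphiP t) cphi.
pose psi (t : R) := 'D_v f (x + a *: v + t *: w).
have dpsiP (t : R) : is_derive t (1:R) psi ('D_w ('D_v f) (x + a *: v + t *: w)).
  exact: is_derive_line.
have cpsi : {within `[0, h], continuous psi}.
  apply: derivable_within_continuous => t _.
  exact: (@ex_derive _ _ _ _ _ _ _ (dpsiP t)).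
have [b /[!in_itv]/= /andP[b0 bh] Eb] := MVT h0 (fun t _ => dpsiP t) cpsi.
exists a, b; split; [by rewrite (ltW a0) ltW | by rewrite (ltW b0) ltW |].
move: Ea Eb; rewrite /phi /psi /dphi /= !scale0r !addr0 !subr0 => -> <-.
by rewrite addrAC.
Qed.

Lemma partial_funC i j f : f \in smooth ->
  partial_fun i (partial_fun j f) = partial_fun j (partial_fun i f).
Proof.
move=> fs; apply/funext => x.
have cont k l : continuous (partial_fun k (partial_fun l f)).
  have /asboolP/(_ 0%N) := smooth_partial k (smooth_partial l fs).
  exact: classC_cont.
apply/eqP; rewrite -subr_eq0 -normr_le0; apply/ler_addgt0Pl => e e0; rewrite addr0.
pose ei : V := delta_mx 0 i; pose ej : V := delta_mx 0 j.
have e20 : 0 < e / 2 by rewrite divr_gt0.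
have near_x k l : exists2 d : R, 0 < d & forall y, `|x - y| < d ->
    `|partial_fun k (partial_fun l f) x - partial_fun k (partial_fun l f) y| < e / 2.
  have /cvgrPdist_lt/(_ _ e20) := cont k l x.
  move=> /nbhs_normP[d /= d0 dP]; exists d => // y xy; exact: dP.
have [d1 d10 P1] := near_x i j; have [d2 d20 P2] := near_x j i.
pose N := `|ei| + `|ej| + 1.
have N0 : 0 < N by rewrite ltr_wpDl // addr_ge0.
pose d := Num.min d1 d2; have d0 : 0 < d by rewrite lt_min d10.
pose h := d / (N *+ 2).
have h0 : 0 < h by rewrite divr_gt0 // mulrn_wgt0.
have small (v w : V) a b : `|v| + `|w| + 1 = N ->
    0 <= a <= h -> 0 <= b <= h -> `|x - (x + a *: v + b *: w)| < d.
  move=> vw /andP[a0 ah] /andP[b0 bh].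
  rewrite -addrA opprD addrA subrr add0r normrN.
  apply: le_lt_trans (ler_normD _ _) _; rewrite !normrZ !ger0_norm //.
  have hN : h * N = d / 2 by rewrite /h; clearbody N; move: N0 => /lt0r_neq0 N0; field.
  apply: (@le_lt_trans _ _ (h * N)).
    by rewrite -vw !mulrDr -[leLHS]addr0 !lerD ?ler_wpM2r // mulr1 ltW.
  by rewrite hN ltr_pdivrMr // ltr_pMr // ltr1n.
have fd k l y : derivable (partial_fun l f) y (delta_mx 0 k : V).
  by apply: smooth_derivable; exact: smooth_partial.
have fd0 l y : derivable f y (delta_mx 0 l : V) by exact: smooth_derivable.
have [a [b [ha hb Eab]]] := second_difference x h0 (fd0 i) (fd j i).
have [a' [b' [ha' hb' Eab']]] := second_difference x h0 (fd0 j) (fd i j).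
set y := x + a *: _ + b *: _ in Eab; set y' := x + a' *: _ + b' *: _ in Eab'.
have Ey : partial_fun j (partial_fun i f) y = partial_fun i (partial_fun j f) y'.
  apply: (mulIf (lt0r_neq0 h0)); apply: (mulIf (lt0r_neq0 h0)).
  rewrite -[LHS]Eab -[RHS]Eab' [x + h *: ei + _]addrAC.
  by rewrite [RHS]addrAC opprB opprD addrA; ring.
have Q1 := P1 y' (lt_le_trans (small _ _ _ _ _ ha' hb') _).
have Q2 := P2 y (lt_le_trans (small _ _ _ _ _ ha hb) _).
have {}Q1 : `|partial_fun i (partial_fun j f) x - partial_fun i (partial_fun j f) y'| < e / 2.
  by apply: Q1; [rewrite /N [`|ei| + _]addrC | rewrite ge_min lexx].
have {}Q2 : `|partial_fun j (partial_fun i f) x - partial_fun j (partial_fun i f) y| < e / 2.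
  by apply: Q2; [| rewrite ge_min lexx orbT].
rewrite Ey in Q2.
rewrite distrC in Q2; rewrite (splitr e).
by apply: le_trans (ler_distD _ _ _) (lerD (ltW Q1) (ltW Q2)).
Qed.

End Smooth.

Record Cinf (R : realType) (s : nat) :=
  MkCinf { Cinf_fun :> 'rV[R]_s -> R; Cinf_smooth : Cinf_fun \in @smooth R s }.

Section CinfAlgebra.
Variables (R : realType) (s : nat).
HB.instance Definition _ := [isSub for @Cinf_fun R s].
HB.instance Definition _ := [Choice of Cinf R s by <:].
Lemma smooth_subring_closed : subring_closed (@smooth R s).
Proof.
split.
- exact: smooth_cst.
- move=> f g hf hg; apply: smoothD => //.
  by rewrite -scaleN1r; exact: smoothZ.
- exact: smoothM.
Qed.
HB.instance Definition _ :=
  GRing.isSubringClosed.Build _ (@smooth R s) smooth_subring_closed.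
HB.instance Definition _ := [SubChoice_isSubComNzRing of Cinf R s by <:].
Lemma smooth_submod_closed : submod_closed (@smooth R s).
Proof.
split; first exact: smooth_cst.
by move=> c f g hf hg; apply: smoothD => //; exact: smoothZ.
Qed.
HB.instance Definition _ :=
  GRing.isSubmodClosed.Build _ _ (@smooth R s) smooth_submod_closed.
HB.instance Definition _ := [SubZmodule_isSubLmodule of Cinf R s by <:].
Lemma Cinf_scalerAl (c : R) (f g : Cinf R s) : c *: (f * g) = (c *: f) * g.
Proof. by apply/val_inj/funext => x; exact: mulrA. Qed.
HB.instance Definition _ :=
  GRing.Lmodule_isLalgebra.Build R (Cinf R s) Cinf_scalerAl.
HB.instance Definition _ := GRing.Lalgebra_isComAlgebra.Build R (Cinf R s).
End CinfAlgebra.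

Definition partial (R : realType) (s : nat) (i : 'I_s) (f : Cinf R s) : Cinf R s :=
  MkCinf (smooth_partial i (Cinf_smooth f)).

Definition coordinate (R : realType) (s : nat) (i : 'I_s) : Cinf R s :=
  MkCinf (@smooth_coord R s i).

Section Partial.
Variables (R : realType) (s : nat).
Implicit Types (f g : Cinf R s) (i j : 'I_s).

Let dvb f i x : derivable (f : 'rV[R]_s -> R) x (delta_mx 0 i).
Proof. exact: smooth_derivable (Cinf_smooth f). Qed.

Lemma partialD i f g : partial i (f + g) = partial i f + partial i g.
Proof. by apply/val_inj; exact: (partial_funD (@dvb f i) (@dvb g i)). Qed.

Lemma partialM i f g : partial i (f * g) = partial i f * g + f * partial i g.
Proof. by apply/val_inj; exact: (partial_funM (@dvb f i) (@dvb g i)). Qed.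

Lemma partialZ i (c : R) f : partial i (c *: f) = c *: partial i f.
Proof. by apply/val_inj/funext => x; exact: (deriveZ c (@dvb f i x)). Qed.

Lemma partialN i f : partial i (- f) = - partial i f.
Proof. by rewrite -[in LHS]scaleN1r partialZ scaleN1r. Qed.

Lemma partialC i j f : partial i (partial j f) = partial j (partial i f).
Proof. by apply/val_inj; exact: partial_funC (Cinf_smooth f). Qed.

Lemma partial_coord i j : partial i (coordinate R j) = (i == j)%:R.
Proof.
apply/val_inj/funext => x /=; rewrite /partial_fun.
rewrite (@derive_val _ _ _ _ _ _ _ (is_derive_coord j x _)) mxE eqxx /= eq_sym.
by case: (i == j).
Qed.
End Partial.

HB.mixin Record Algebra_isPoisson (R : pzRingType) A of GRing.Algebra R A := {
  lie : A -> A -> A;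
  lie_linearl : forall (c : R) (a b x : A),
    lie (c *: a + b) x = c *: lie a x + lie b x;
  lie_linearr : forall (c : R) (x a b : A),
    lie x (c *: a + b) = c *: lie x a + lie x b;
  lie_antisym : forall a b : A, lie a b = - lie b a;
  lie_jacobi : forall a b c : A,
    lie a (lie b c) + lie b (lie c a) + lie c (lie a b) = 0;
  lie_leibniz : forall a b c : A, lie a (b * c) = lie a b * c + b * lie a c
}.

#[short(type="poissonAlgType")]
HB.structure Definition PoissonAlgebra (R : pzRingType) :=
  {A of GRing.Algebra R A & Algebra_isPoisson R A}.

Definition commutator (A : pzRingType) (a b : A) : A := a * b - b * a.

(* Lambda is built as the algebra of all expressions in the elements of
   C^oo(R^s) and the momenta, modulo the least congruence wrel imposing: the laws
   of associative unital R-algebras, the algebra operations of C^oo(R^s), the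
   linearity, antisymmetry and Leibniz rule of the Lie product, and the canonical
   Lie products.  On the free product of C^oo(R^s) with the free algebra on the
   p_i, with no further identification, the Leibniz rule is inconsistent: the two
   expansions of {AB, CD} differ by [A,C]{B,D} - {A,C}[B,D].  "Free" therefore
   means that nothing but the consequences of these rules is identified.  The
   Jacobi identity is not imposed: it is lemma Llie_jacobi. *)
Inductive word (R : realType) (s : nat) : Type :=
| WFun of Cinf R s
| WMom of 'I_s
| WAdd of word R s & word R s
| WScale of R & word R s
| WMul of word R s & word R s
| WLie of word R s & word R s.

HB.instance Definition _ (R : realType) (s : nat) := gen_eqMixin (word R s).
HB.instance Definition _ (R : realType) (s : nat) := gen_choiceMixin (word R s).

Section Words.
Variables (R : realType) (s : nat).
Local Notation word := (word R s).
Implicit Types (a b c d : word) (f g : Cinf R s) (k l : R) (i j : 'I_s).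

Inductive wrel : word -> word -> Prop :=
| wrel_refl a : wrel a a
| wrel_sym a b : wrel a b -> wrel b a
| wrel_trans a b c : wrel a b -> wrel b c -> wrel a c
| wrel_add a b c d : wrel a b -> wrel c d -> wrel (WAdd a c) (WAdd b d)
| wrel_scale k a b : wrel a b -> wrel (WScale k a) (WScale k b)
| wrel_mul a b c d : wrel a b -> wrel c d -> wrel (WMul a c) (WMul b d)
| wrel_lie a b c d : wrel a b -> wrel c d -> wrel (WLie a c) (WLie b d)
| wrel_addA a b c : wrel (WAdd a (WAdd b c)) (WAdd (WAdd a b) c)
| wrel_addC a b : wrel (WAdd a b) (WAdd b a)
| wrel_add0 a : wrel (WAdd (WFun 0) a) a
| wrel_addN a : wrel (WAdd (WScale (- 1) a) a) (WFun 0)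
| wrel_scaleA k l a : wrel (WScale k (WScale l a)) (WScale (k * l) a)
| wrel_scale1 a : wrel (WScale 1 a) a
| wrel_scaleDr k a b : wrel (WScale k (WAdd a b)) (WAdd (WScale k a) (WScale k b))
| wrel_scaleDl k l a : wrel (WScale (k + l) a) (WAdd (WScale k a) (WScale l a))
| wrel_mulA a b c : wrel (WMul a (WMul b c)) (WMul (WMul a b) c)
| wrel_mul1l a : wrel (WMul (WFun 1) a) a
| wrel_mul1r a : wrel (WMul a (WFun 1)) a
| wrel_mulDl a b c : wrel (WMul (WAdd a b) c) (WAdd (WMul a c) (WMul b c))
| wrel_mulDr a b c : wrel (WMul a (WAdd b c)) (WAdd (WMul a b) (WMul a c))
| wrel_scaleAl k a b : wrel (WScale k (WMul a b)) (WMul (WScale k a) b)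
| wrel_scaleAr k a b : wrel (WScale k (WMul a b)) (WMul a (WScale k b))
| wrel_funD f g : wrel (WFun (f + g)) (WAdd (WFun f) (WFun g))
| wrel_funZ k f : wrel (WFun (k *: f)) (WScale k (WFun f))
| wrel_funM f g : wrel (WFun (f * g)) (WMul (WFun f) (WFun g))
| wrel_lieD a b c : wrel (WLie (WAdd a b) c) (WAdd (WLie a c) (WLie b c))
| wrel_lieZ k a b : wrel (WLie (WScale k a) b) (WScale k (WLie a b))
| wrel_lieC a b : wrel (WLie a b) (WScale (- 1) (WLie b a))
| wrel_leibniz a b c :
    wrel (WLie a (WMul b c)) (WAdd (WMul (WLie a b) c) (WMul b (WLie a c)))
| wrel_fun_mom f i : wrel (WLie (WFun f) (WMom _ i)) (WFun (partial i f))
| wrel_fun_fun f g : wrel (WLie (WFun f) (WFun g)) (WFun 0)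
| wrel_mom_mom i j : wrel (WLie (WMom _ i) (WMom _ j)) (WFun 0).

Definition wrelb : rel word := fun a b => `[< wrel a b >].

Lemma wrelb_refl : reflexive wrelb.
Proof. by move=> a; apply/asboolP; exact: wrel_refl. Qed.

Lemma wrelb_sym : symmetric wrelb.
Proof.
by move=> a b; apply/asboolP/asboolP => h; exact: wrel_sym.
Qed.

Lemma wrelb_trans : transitive wrelb.
Proof.
move=> b a c /asboolP h1 /asboolP h2; apply/asboolP; exact: wrel_trans h1 h2.
Qed.

Canonical wrel_equiv := EquivRel wrelb wrelb_refl wrelb_sym wrelb_trans.
End Words.

Definition Lambda (R : realType) (s : nat) : Type := {eq_quot (@wrel_equiv R s)}.
HB.instance Definition _ (R : realType) (s : nat) := Choice.on (Lambda R s).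
HB.instance Definition _ (R : realType) (s : nat) :=
  EqQuotient.on (Lambda R s).

Section LambdaPi.
Variables (R : realType) (s : nat).
Local Notation L := (Lambda R s).

Definition Lpi (a : word R s) : L := \pi_L a.

Lemma LpiP a b : wrel a b -> Lpi a = Lpi b.
Proof. by move=> h; apply/eqmodP/asboolP. Qed.

Lemma Lpi_rel a b : Lpi a = Lpi b -> wrel a b.
Proof. by move=> /eqmodP/asboolP. Qed.

Lemma Lpi_repr (A : L) : Lpi (repr A) = A.
Proof. exact: reprK. Qed.

Lemma repr_rel a : wrel (repr (Lpi a)) a.
Proof. by apply: Lpi_rel; rewrite Lpi_repr. Qed.

(* locked: otherwise unification unfolds the operations of L to representatives *)
Definition Ladd := locked (fun A B : L => Lpi (WAdd (repr A) (repr B))).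
Definition Lscale := locked (fun (k : R) (A : L) => Lpi (WScale k (repr A))).
Definition Lmul := locked (fun A B : L => Lpi (WMul (repr A) (repr B))).
Definition Llie := locked (fun A B : L => Lpi (WLie (repr A) (repr B))).

Lemma LaddE a b : Ladd (Lpi a) (Lpi b) = Lpi (WAdd a b).
Proof. by rewrite /Ladd -lock; apply/LpiP/wrel_add; exact: repr_rel. Qed.
Lemma LscaleE k a : Lscale k (Lpi a) = Lpi (WScale k a).
Proof. by rewrite /Lscale -lock; apply/LpiP/wrel_scale; exact: repr_rel. Qed.
Lemma LmulE a b : Lmul (Lpi a) (Lpi b) = Lpi (WMul a b).
Proof. by rewrite /Lmul -lock; apply/LpiP/wrel_mul; exact: repr_rel. Qed.
Lemma LlieE a b : Llie (Lpi a) (Lpi b) = Lpi (WLie a b).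
Proof. by rewrite /Llie -lock; apply/LpiP/wrel_lie; exact: repr_rel. Qed.

Lemma Lambda_word (P : L -> Prop) : (forall a, P (Lpi a)) -> forall A, P A.
Proof. by move=> h A; rewrite -(Lpi_repr A). Qed.

Definition LE := (LaddE, LscaleE, LmulE, LlieE).

Ltac by_rel := repeat elim/Lambda_word => ?; rewrite !LE; apply: LpiP; by constructor.

Let LaddA : associative Ladd. Proof. by_rel. Qed.
Let LaddC : commutative Ladd. Proof. by_rel. Qed.
Let Ladd0 : left_id (Lpi (WFun 0)) Ladd. Proof. by_rel. Qed.
Let LaddN : left_inverse (Lpi (WFun 0)) (Lscale (- 1)) Ladd. Proof. by_rel. Qed.
HB.instance Definition _ := GRing.isZmodule.Build L LaddA LaddC Ladd0 LaddN.

Let LscaleA (k l : R) (A : L) : Lscale k (Lscale l A) = Lscale (k * l) A.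
Proof. by move: A; by_rel. Qed.
Let Lscale1 : left_id 1 Lscale. Proof. by_rel. Qed.
Let LscaleDr : right_distributive Lscale Ladd. Proof. by move=> k; by_rel. Qed.
Let LscaleDl (A : L) : {morph Lscale^~ A : k l / k + l >-> Ladd k l}.
Proof. by move=> k l; move: A; by_rel. Qed.
HB.instance Definition _ := GRing.Zmodule_isLmodule.Build R L
  LscaleA Lscale1 LscaleDr LscaleDl.

Let LmulA : associative Lmul. Proof. by_rel. Qed.
Let Lmul1l : left_id (Lpi (WFun 1)) Lmul. Proof. by_rel. Qed.
Let Lmul1r : right_id (Lpi (WFun 1)) Lmul. Proof. by_rel. Qed.
Let LmulDl : left_distributive Lmul Ladd. Proof. by_rel. Qed.
Let LmulDr : right_distributive Lmul Ladd. Proof. by_rel. Qed.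

(* The algebra is not zero: functions act on C^oo(R^s) by multiplication, the
   momenta by - d/dq_i, and the Lie product by the commutator *)
Fixpoint schroedinger (a : word R s) : Cinf R s -> Cinf R s :=
  match a with
  | WFun f => fun u => f * u
  | WMom i => fun u => - partial i u
  | WAdd a b => fun u => schroedinger a u + schroedinger b u
  | WScale k a => fun u => k *: schroedinger a u
  | WMul a b => fun u => schroedinger a (schroedinger b u)
  | WLie a b => fun u =>
      schroedinger a (schroedinger b u) - schroedinger b (schroedinger a u)
  end.

Lemma schroedinger_linear a : linear (schroedinger a).
Proof.
elim: a => [f|i|a IHa b IHb|k a IHa|a IHa b IHb|a IHa b IHb] l u v /=.
- by rewrite mulrDr scalerAr.
- by rewrite partialD partialZ opprD scalerN.
- by rewrite IHa IHb scalerDr addrACA.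
- by rewrite IHa scalerDr !scalerA mulrC.
- by rewrite IHb IHa.
- by rewrite IHb IHa IHa IHb scalerBr opprD addrACA.
Qed.

Lemma schroedingerD a u v :
  schroedinger a (u + v) = schroedinger a u + schroedinger a v.
Proof. by rewrite -{1}[u]scale1r schroedinger_linear scale1r. Qed.

Lemma schroedinger0 a : schroedinger a 0 = 0.
Proof. by apply: (addrI (schroedinger a 0)); rewrite -schroedingerD !addr0. Qed.

Lemma schroedingerZ a k u : schroedinger a (k *: u) = k *: schroedinger a u.
Proof. by rewrite -[in LHS](addr0 (k *: u)) schroedinger_linear schroedinger0 addr0. Qed.

Lemma schroedingerB a u v :
  schroedinger a (u - v) = schroedinger a u - schroedinger a v.
Proof. by rewrite schroedingerD -[in LHS](scaleN1r v) schroedingerZ scaleN1r. Qed.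

Lemma schroedinger_rel a b : wrel a b -> schroedinger a =1 schroedinger b.
Proof.
elim=> {a b} /=.
- by [].
- by move=> a b _ + u => ->.
- by move=> a b c _ IH1 _ IH2 u; rewrite IH1.
- by move=> a b c d _ IH1 _ IH2 u; rewrite IH1 IH2.
- by move=> k a b _ IH u; rewrite IH.
- by move=> a b c d _ IH1 _ IH2 u; rewrite IH1 IH2.
- by move=> a b c d _ IH1 _ IH2 u; rewrite !IH1 !IH2.
- by move=> a b c u; rewrite addrA.
- by move=> a b u; rewrite addrC.
- by move=> a u; rewrite mul0r add0r.
- by move=> a u; rewrite mul0r scaleN1r addNr.
- by move=> k l a u; rewrite scalerA.
- by move=> a u; rewrite scale1r.
- by move=> k a b u; rewrite scalerDr.
- by move=> k l a u; rewrite scalerDl.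
- by [].
- by move=> a u; rewrite mul1r.
- by move=> a u; rewrite mul1r.
- by [].
- by move=> a b c u; rewrite schroedingerD.
- by [].
- by move=> k a b u; rewrite schroedingerZ.
- by move=> f g u; rewrite mulrDl.
- by move=> k f u; rewrite scalerAl.
- by move=> f g u; rewrite mulrA.
- by move=> a b c u; rewrite schroedingerD opprD addrACA.
- by move=> k a b u; rewrite schroedingerZ scalerBr.
- by move=> a b u; rewrite scaleN1r opprB.
- by move=> a b c u; rewrite schroedingerB addrA subrK.
- move=> f i u; rewrite mulrN opprK partialM addrCA.
  by rewrite addNr addr0.
- by move=> f g u; rewrite mulrCA subrr mul0r.
- by move=> i j u; rewrite !partialN partialC subrr mul0r.
Qed.

Let L1_neq0 : Lpi (WFun 1) != 0.
Proof.
apply/eqP => /Lpi_rel/schroedinger_rel/(_ 1) /= /eqP.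
by rewrite mulr1 mul0r; apply/negP; exact: oner_neq0.
Qed.
HB.instance Definition _ :=
  GRing.Zmodule_isNzRing.Build L
  LmulA Lmul1l Lmul1r LmulDl LmulDr L1_neq0.

Lemma LpiD a b : Lpi a + Lpi b = Lpi (WAdd a b). Proof. exact: LaddE. Qed.
Lemma LpiZ k a : k *: Lpi a = Lpi (WScale k a). Proof. exact: LscaleE. Qed.
Lemma LpiM a b : Lpi a * Lpi b = Lpi (WMul a b). Proof. exact: LmulE. Qed.

Definition LpiE := (LpiD, LpiZ, LpiM, LlieE).

Ltac by_ring_rel :=
  repeat elim/Lambda_word => ?; rewrite !LpiE; apply: LpiP; by constructor.

Let LscaleAl (k : R) (A B : L) : k *: (A * B) = (k *: A) * B.
Proof. by move: A B; by_ring_rel. Qed.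
Let LscaleAr (k : R) (A B : L) : k *: (A * B) = A * (k *: B).
Proof. by move: A B; by_ring_rel. Qed.
HB.instance Definition _ := GRing.Lmodule_isLalgebra.Build R L LscaleAl.
HB.instance Definition _ := GRing.Lalgebra_isAlgebra.Build R L LscaleAr.

Definition fvar (f : Cinf R s) : L := Lpi (WFun f).
Definition qvar (i : 'I_s) : L := fvar (coordinate R i).
Definition pvar (i : 'I_s) : L := Lpi (WMom R i).

Let LoppE a : - Lpi a = Lpi (WScale (- 1) a).
Proof. exact: LscaleE. Qed.

Let LlieC (A B : L) : Llie A B = - Llie B A.
Proof. by move: A B; do 2! elim/Lambda_word => ?; rewrite !LlieE LoppE; exact/LpiP/wrel_lieC. Qed.
Let LlieD (A B C : L) : Llie (A + B) C = Llie A C + Llie B C.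
Proof. by move: A B C; by_ring_rel. Qed.
Let LlieZ (k : R) (A B : L) : Llie (k *: A) B = k *: Llie A B.
Proof. by move: A B; by_ring_rel. Qed.
Let Lleibniz (A B C : L) : Llie A (B * C) = Llie A B * C + B * Llie A C.
Proof. by move: A B C; by_ring_rel. Qed.
Let Llie_linl (k : R) (A B C : L) : Llie (k *: A + B) C = k *: Llie A C + Llie B C.
Proof. by rewrite LlieD LlieZ. Qed.
Let Llie_linr (k : R) (C A B : L) : Llie C (k *: A + B) = k *: Llie C A + Llie C B.
Proof. by rewrite LlieC Llie_linl opprD -scalerN -!(LlieC C). Qed.
Let LlieDr (A B C : L) : Llie A (B + C) = Llie A B + Llie A C.
Proof. by rewrite -[B]scale1r Llie_linr !scale1r. Qed.
Let Llie0 (A : L) : Llie A 0 = 0.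
Proof. by apply: (addrI (Llie A 0)); rewrite -LlieDr !addr0. Qed.
Let LlieZr (k : R) (A B : L) : Llie A (k *: B) = k *: Llie A B.
Proof. by rewrite -[k *: B]addr0 Llie_linr Llie0 addr0. Qed.

Let fvar0 : fvar 0 = 0. Proof. by []. Qed.
Let lie_fp f i : Llie (fvar f) (pvar i) = fvar (partial i f).
Proof. by rewrite LlieE; exact/LpiP/wrel_fun_mom. Qed.
Let lie_pf f i : Llie (pvar i) (fvar f) = - fvar (partial i f).
Proof. by rewrite LlieC lie_fp. Qed.
Let lie_ff f g : Llie (fvar f) (fvar g) = 0.
Proof. by rewrite LlieE; exact/LpiP/wrel_fun_fun. Qed.
Let lie_pp i j : Llie (pvar i) (pvar j) = 0.
Proof. by rewrite LlieE; exact/LpiP/wrel_mom_mom. Qed.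

(* Lambda_polynomial: C^oo(R^s) and the p_i generate Lambda as an associative
   algebra, so the Lie product produces no new elements *)
Inductive is_polynomial : L -> Prop :=
| poly_fvar f : is_polynomial (fvar f)
| poly_pvar i : is_polynomial (pvar i)
| poly_scale (k : R) A : is_polynomial A -> is_polynomial (k *: A)
| poly_add A B : is_polynomial A -> is_polynomial B -> is_polynomial (A + B)
| poly_mul A B : is_polynomial A -> is_polynomial B -> is_polynomial (A * B).

Let poly_opp A : is_polynomial A -> is_polynomial (- A).
Proof. by move=> pA; rewrite -scaleN1r; exact: poly_scale. Qed.

Let poly_lie A B : is_polynomial A -> is_polynomial B -> is_polynomial (Llie A B).
Proof.
move=> pA; elim: pA B => {A} [f|i|k A pA IH|A A' pA IH pA' IH'|A A' pA IH pA' IH'] B pB.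
- elim: pB => {B} [g|j|k B pB IH|B B' pB IH pB' IH'|B B' pB IH pB' IH'].
  + by rewrite lie_ff -fvar0; exact: poly_fvar.
  + by rewrite lie_fp; exact: poly_fvar.
  + by rewrite LlieZr; exact: poly_scale.
  + by rewrite LlieDr; exact: poly_add.
  + by rewrite Lleibniz; apply: poly_add; exact: poly_mul.
- elim: pB => {B} [g|j|k B pB IH|B B' pB IH pB' IH'|B B' pB IH pB' IH'].
  + by rewrite lie_pf; apply: poly_opp; exact: poly_fvar.
  + by rewrite lie_pp -fvar0; exact: poly_fvar.
  + by rewrite LlieZr; exact: poly_scale.
  + by rewrite LlieDr; exact: poly_add.
  + by rewrite Lleibniz; apply: poly_add; exact: poly_mul.
- by rewrite LlieZ; apply: poly_scale; exact: IH.
- by rewrite LlieD; apply: poly_add; [exact: IH|exact: IH'].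
- rewrite LlieC; apply: poly_opp; rewrite Lleibniz.
  apply: poly_add; apply: poly_mul => //; rewrite LlieC; apply: poly_opp.
    exact: IH.
  exact: IH'.
Qed.

Lemma Lambda_polynomial A : is_polynomial A.
Proof.
elim/Lambda_word: A => a.
elim: a => [f|i|a IHa b IHb|k a IHa|a IHa b IHb|a IHa b IHb].
- exact: poly_fvar.
- exact: poly_pvar.
- by rewrite -LpiD; exact: poly_add.
- by rewrite -LpiZ; exact: poly_scale.
- by rewrite -LpiM; exact: poly_mul.
- by rewrite -LlieE; exact: poly_lie.
Qed.

Let jac (A B C : L) : L :=
  Llie A (Llie B C) + Llie B (Llie C A) + Llie C (Llie A B).

Let jac_cycle A B C : jac A B C = jac B C A.
Proof. by rewrite /jac -addrA addrC. Qed.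

Let jacE A B C :
  jac A B C = Llie A (Llie B C) - Llie B (Llie A C) - Llie (Llie A B) C.
Proof.
by rewrite /jac (LlieC C A) (LlieC C (Llie A B)) -scaleN1r LlieZr scaleN1r.
Qed.

Let jac_zero_in (A B : L) :
  (forall f, jac A B (fvar f) = 0) -> (forall i, jac A B (pvar i) = 0) ->
  forall C, jac A B C = 0.
Proof.
move=> hf hp C; elim: (Lambda_polynomial C) => {C}
  [f|i|k C _ IH|C C' _ IH _ IH'|C C' _ IH _ IH'] //.
- have -> : jac A B (k *: C) = k *: jac A B C.
    by rewrite !jacE !LlieZr -!scalerBr.
  by rewrite IH scaler0.
- have -> : jac A B (C + C') = jac A B C + jac A B C'.
    by rewrite !jacE !LlieDr !opprD [in LHS](addrACA (Llie A _)) [LHS]addrACA.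
  by rewrite IH IH' addr0.
- have -> : jac A B (C * C') = jac A B C * C' + C * jac A B C'.
    rewrite !jacE !Lleibniz !LlieDr !Lleibniz !mulrBl !mulrBr.
    set b := Llie A C * Llie B C'; set c := Llie B C * Llie A C'.
    set a := _ * C'; set d := C * _; set a' := _ * C'; set d' := C * _.
    rewrite [b + d]addrC [c + d']addrC (addrACA a) (addrACA a') (addrC b c).
    rewrite opprD (addrACA (a + d)) subrr addr0 !opprD (addrACA a d).
    by rewrite (addrACA (a - a')).
  by rewrite IH IH' mul0r mulr0 addr0.
Qed.

Lemma Llie_jacobi (A B C : L) :
  Llie A (Llie B C) + Llie B (Llie C A) + Llie C (Llie A B) = 0.
Proof.
rewrite -/(jac A B C).
have fff f g h : jac (fvar f) (fvar g) (fvar h) = 0.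
  by rewrite /jac !lie_ff ?Llie0 ?addr0.
have ffp f g i : jac (fvar f) (fvar g) (pvar i) = 0.
  by rewrite /jac lie_fp lie_pf lie_ff -scaleN1r LlieZr !lie_ff ?Llie0 scaler0 ?addr0.
have fpp f i j : jac (fvar f) (pvar i) (pvar j) = 0.
  rewrite /jac lie_fp lie_pf lie_pp -scaleN1r LlieZr !lie_pf ?Llie0 add0r.
  by rewrite scaleN1r opprK partialC subrr.
have ppp i j k : jac (pvar i) (pvar j) (pvar k) = 0.
  by rewrite /jac !lie_pp ?Llie0 ?addr0.
have fpf f i g : jac (fvar f) (pvar i) (fvar g) = 0.
  by rewrite -(jac_cycle (fvar g)) ffp.
have pff i f g : jac (pvar i) (fvar f) (fvar g) = 0 by rewrite jac_cycle ffp.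
have pfp i f j : jac (pvar i) (fvar f) (pvar j) = 0 by rewrite jac_cycle fpp.
have ppf i j f : jac (pvar i) (pvar j) (fvar f) = 0.
  by rewrite -(jac_cycle (fvar f)) fpp.
apply: jac_zero_in C => [f|i]; rewrite -jac_cycle; apply: jac_zero_in B => [g|j];
  rewrite -jac_cycle; apply: jac_zero_in A => [h|k];
  by [exact: fff|exact: ffp|exact: fpf|exact: pff
     |exact: fpp|exact: pfp|exact: ppf|exact: ppp].
Qed.

HB.instance Definition _ := Algebra_isPoisson.Build R L
  Llie_linl Llie_linr LlieC Llie_jacobi Lleibniz.

Lemma lie_fvar_pvar f i : lie (fvar f) (pvar i) = fvar (partial i f).
Proof. exact: lie_fp. Qed.
Lemma lie_fvar_fvar f g : lie (fvar f) (fvar g) = 0.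
Proof. exact: lie_ff. Qed.
Lemma lie_pvar_pvar i j : lie (pvar i) (pvar j) = 0.
Proof. exact: lie_pp. Qed.

Lemma fvar_linear : linear fvar.
Proof.
move=> k f g; rewrite LpiZ LpiD; apply: LpiP.
by apply: wrel_trans (wrel_funD _ _) (wrel_add (wrel_funZ _ _) (wrel_refl _)).
Qed.
Lemma fvar_monoid_morphism : monoid_morphism fvar.
Proof.
by split=> // f g; rewrite LpiM; exact/LpiP/wrel_funM.
Qed.
HB.instance Definition _ := GRing.isLinear.Build R (Cinf R s) L _ fvar fvar_linear.
HB.instance Definition _ :=
  GRing.isMonoidMorphism.Build (Cinf R s) L fvar fvar_monoid_morphism.
Lemma fvar_inj : injective fvar.
Proof.
by move=> f g /Lpi_rel/schroedinger_rel/(_ 1) /=; rewrite !mulr1.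
Qed.

Lemma lie_qvar_pvar i j : lie (qvar i) (pvar j) = (i == j)%:R.
Proof. by rewrite lie_fvar_pvar partial_coord eq_sym rmorph_nat. Qed.

Fixpoint interp (P : poissonAlgType R) (F : Cinf R s -> P) (m : 'I_s -> P)
    (a : word R s) : P :=
  let interp := interp F m in
  match a with
  | WFun f => F f
  | WMom i => m i
  | WAdd a b => interp a + interp b
  | WScale k a => k *: interp a
  | WMul a b => interp a * interp b
  | WLie a b => lie (interp a) (interp b)
  end.

Let interp_rel (P : poissonAlgType R) (F : {lrmorphism Cinf R s -> P})
    (m : 'I_s -> P) :
  (forall f i, lie (F f) (m i) = F (partial i f)) ->
  (forall f g, lie (F f) (F g) = 0) ->
  (forall i j, lie (m i) (m j) = 0) ->
  forall a b, wrel a b -> interp F m a = interp F m b.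
Proof.
move=> lie_Fm lie_FF lie_mm a b; elim=> {a b} /=.
- by [].
- by move=> a b _ ->.
- by move=> a b c _ -> _ ->.
- by move=> a b c d _ -> _ ->.
- by move=> k a b _ ->.
- by move=> a b c d _ -> _ ->.
- by move=> a b c d _ -> _ ->.
- by move=> a b c; rewrite addrA.
- by move=> a b; rewrite addrC.
- by move=> a; rewrite linear0 add0r.
- by move=> a; rewrite scaleN1r addNr linear0.
- by move=> k l a; rewrite scalerA.
- by move=> a; rewrite scale1r.
- by move=> k a b; rewrite scalerDr.
- by move=> k l a; rewrite scalerDl.
- by move=> a b c; rewrite mulrA.
- by move=> a; rewrite rmorph1 mul1r.
- by move=> a; rewrite rmorph1 mulr1.
- by move=> a b c; rewrite mulrDl.
- by move=> a b c; rewrite mulrDr.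
- by move=> k a b; rewrite scalerAl.
- by move=> k a b; rewrite scalerAr.
- by move=> f g; rewrite linearD.
- by move=> k f; rewrite linearZ.
- by move=> f g; rewrite rmorphM.
- by move=> a b c; rewrite -[interp F m a]scale1r lie_linearl !scale1r.
- move=> k a b; rewrite -[k *: interp F m a]addr0 lie_linearl.
  suff -> : lie (0 : P) (interp F m b) = 0 by rewrite addr0.
  have := lie_linearl 1 0 0 (interp F m b); rewrite !scale1r addr0.
  by move=> /esym/(canRL (addrK _)); rewrite subrr.
- by move=> a b; rewrite scaleN1r lie_antisym.
- by move=> a b c; rewrite lie_leibniz.
- exact: lie_Fm.
- by move=> f g; rewrite lie_FF linear0.
- by move=> i j; rewrite lie_mm linear0.
Qed.

Lemma Lambda_universal (P : poissonAlgType R) (F : {lrmorphism Cinf R s -> P})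
    (m : 'I_s -> P) :
  (forall f i, lie (F f) (m i) = F (partial i f)) ->
  (forall f g, lie (F f) (F g) = 0) ->
  (forall i j, lie (m i) (m j) = 0) ->
  exists2 Phi : L -> P,
    [/\ linear Phi, monoid_morphism Phi &
        forall A B, Phi (lie A B) = lie (Phi A) (Phi B)] &
    (forall f, Phi (fvar f) = F f) /\ (forall i, Phi (pvar i) = m i).
Proof.
move=> lie_Fm lie_FF lie_mm.
pose Phi (A : L) : P := interp F m (repr A).
have PhiE a : Phi (Lpi a) = interp F m a.
  by apply: interp_rel => //; exact: repr_rel.
exists Phi; last by split=> [f|i]; rewrite PhiE.
split.
- move=> k; elim/Lambda_word => a; elim/Lambda_word => b.
  by rewrite LpiZ LpiD !PhiE.
- split; first by rewrite PhiE /= rmorph1.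
  by elim/Lambda_word => a; elim/Lambda_word => b; rewrite LpiM !PhiE.
- elim/Lambda_word => a; elim/Lambda_word => b.
  by rewrite [lie _ _]LlieE !PhiE.
Qed.

Record canonical_involution (star : L -> L) : Prop := CanonicalInvolution {
  star_linear : linear star;
  starM : forall A B, star (A * B) = star B * star A;
  starK : involutive star;
  star_lie : forall A B, lie (star A) (star B) = star (lie A B);
  star_qvar : forall i, star (qvar i) = qvar i;
  star_pvar : forall i, star (pvar i) = pvar i
}.

Fixpoint wstar (a : word R s) : word R s :=
  match a with
  | WFun f => WFun f
  | WMom i => WMom R i
  | WAdd a b => WAdd (wstar a) (wstar b)
  | WScale k a => WScale k (wstar a)
  | WMul a b => WMul (wstar b) (wstar a)
  | WLie a b => WLie (wstar a) (wstar b)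
  end.

Lemma wstar_rel a b : wrel a b -> wrel (wstar a) (wstar b).
Proof.
elim=> {a b} /=; try by move=> *; constructor.
- by move=> a b c _ h1 _ h2; exact: wrel_trans h1 h2.
- by move=> a b c; apply: wrel_sym; exact: wrel_mulA.
- move=> f g; rewrite [f * g]mulrC; exact: wrel_funM.
- move=> a b c; apply: wrel_trans (wrel_leibniz _ _ _) _; exact: wrel_addC.
Qed.

Lemma wstarK : involutive wstar.
Proof. by elim=> //= [a -> b ->|k a ->|a -> b ->|a -> b ->]. Qed.

Lemma canonical_involution_exists : exists star, canonical_involution star.
Proof.
pose star (A : L) : L := Lpi (wstar (repr A)).
have starE a : star (Lpi a) = Lpi (wstar a).
  by apply/LpiP/wstar_rel; exact: repr_rel.
exists star; split.
- move=> k; elim/Lambda_word => a; elim/Lambda_word => b.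
  by rewrite LpiZ LpiD !starE LpiZ LpiD.
- by elim/Lambda_word => a; elim/Lambda_word => b; rewrite LpiM !starE LpiM.
- by elim/Lambda_word => a; rewrite !starE wstarK.
- elim/Lambda_word => a; elim/Lambda_word => b.
  by rewrite [in RHS]/lie /= LlieE !starE [LHS]LlieE.
- by move=> i; rewrite starE.
- by move=> i; rewrite starE.
Qed.
End LambdaPi.

(* Main.v *)
(* Expanding {AB, CD} by the Leibniz rule in its first or in its second argument
   first gives [A,C]{B,D} = {A,C}[B,D]; replacing B by EB inserts an arbitrary
   factor E (Farkas and Letzter).  When {q,p} = 1, comparing with the pair (q,p)
   shows that Z = [q,p] is central and [A,B] = Z{A,B}; since {C, .} is a derivation
   of both products, {C,Z}{q,p} = 0.  For s = 0 there are no momenta, Lambda is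
   commutative and Z = 0. *)
Require Import Defs.
From mathcomp Require Import all_boot all_order all_algebra.
From mathcomp Require Import all_classical all_reals all_analysis.
Import GRing.Theory.
Local Open Scope ring_scope.

Lemma lie0l {R : pzRingType} {P : poissonAlgType R} (A : P) : lie (0 : P) A = 0.
Proof.
have := lie_linearl 1 0 0 A; rewrite !scale1r addr0.
by move=> /esym/(canRL (addrK _)); rewrite subrr.
Qed.

Lemma lieBr {R : pzRingType} {P : poissonAlgType R} (A B C : P) :
  lie A (B - C) = lie A B - lie A C.
Proof. by rewrite [B - C]addrC -scaleN1r lie_linearr scaleN1r addrC. Qed.

Lemma lie_leibnizl {R : pzRingType} {P : poissonAlgType R} (A B C : P) :
  lie (A * B) C = A * lie B C + lie A C * B.
Proof.
rewrite (lie_antisym A C) (lie_antisym B C) lie_antisym lie_leibniz.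
by rewrite opprD mulrN mulNr addrC.
Qed.

Lemma commutatorMl {A : pzRingType} (a b c : A) :
  commutator (a * b) c = a * commutator b c + commutator a c * b.
Proof. by rewrite /commutator mulrBr mulrBl !mulrA addrA subrK. Qed.

Lemma commutator_lie {R : pzRingType} {P : poissonAlgType R} (A B C D : P) :
  commutator A C * lie B D = lie A C * commutator B D.
Proof.
have : lie (A * B) (C * D) = lie (A * B) C * D + C * lie (A * B) D.
  exact: lie_leibniz.
(* The terms [A * lie B C * D] and [C * lie A D * B] occur in both expansions and cancel. *)
rewrite !lie_leibnizl !lie_leibniz !mulrDr !mulrDl !mulrA !addrA => /addIr.
rewrite -!addrA => /addrI /(canRL (addrK _)) ACBD.
by rewrite mulNr mulrN !mulrA ACBD addrAC addrK.
Qed.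

Lemma commutator_mul_lie {R : pzRingType} {P : poissonAlgType R} (A B C D E : P) :
  commutator A C * E * lie B D = lie A C * E * commutator B D.
Proof.
have := commutator_lie A (E * B) C D.
(* Of the two terms on each side, those ending in [B] agree by [commutator_lie] for [A], [E], [C],
   [D], which leaves the claim. *)
rewrite lie_leibnizl commutatorMl !mulrDr !mulrA commutator_lie.
exact: addIr.
Qed.

Lemma lie_commutator {R : pzRingType} {P : poissonAlgType R} (A B C : P) :
  lie A (commutator B C) = commutator (lie A B) C + commutator B (lie A C).
Proof.
rewrite /commutator lieBr !lie_leibniz [lie A C * B + _]addrC opprD.
by rewrite addrACA.
Qed.

Lemma lie_jacobi_derivation {R : pzRingType} {P : poissonAlgType R} (A B C : P) :
  lie A (lie B C) = lie (lie A B) C + lie B (lie A C).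
Proof.
apply/eqP; rewrite -subr_eq0 opprD -(lie_antisym C) addrA addrAC; apply/eqP.
rewrite -[RHS](lie_jacobi A B C); congr (_ + _ + _).
by rewrite [lie C A]lie_antisym -[- lie A C]sub0r lieBr [lie B 0]lie_antisym lie0l oppr0 sub0r.
Qed.

Section CanonicalPair.
Context {R : pzRingType} {P : poissonAlgType R} {q p : P}.
Hypothesis lie_qp : lie q p = 1.

(** This is [commutator_lie] for the pairs [(q, p)] and [(A, B)], the factor [lie q p] being 1. *)
Lemma commutator_canonical (A B : P) : commutator A B = commutator q p * lie A B.
Proof. by rewrite commutator_lie lie_qp mul1r. Qed.

Lemma canonical_central (A : P) : commutator (commutator q p) A = 0.
Proof.
(* With [(q, p)] as both pairs and [A] as inserted factor, the identity reads Z A = A Z for Z =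
   [q,p]. *)
have := commutator_mul_lie q q p p A; rewrite /commutator lie_qp mul1r mulr1 => ->.
exact: subrr.
Qed.

Lemma lie_canonical (A : P) : lie (commutator q p) A = 0.
Proof.
rewrite lie_antisym; apply/eqP; rewrite oppr_eq0; apply/eqP.
have := lie_commutator A q p.
(* Both commutators acquire the left factor Z, and Jacobi sums their brackets to Z {A,{q,p}}.
   Expanding {A, Z{q,p}} on the left gives the same term plus {A,Z}, which therefore vanishes. *)
rewrite (commutator_canonical (lie A q)) (commutator_canonical q (lie A p)).
rewrite -mulrDr -lie_jacobi_derivation [in LHS](commutator_canonical q p).
by rewrite lie_leibniz lie_qp mulr1 -[RHS]add0r => /addIr.
Qed.

End CanonicalPair.

(** As ['I_0] is empty, only functions remain as generators, and these commute. The induction on [B]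
    is needed only when [A] is a function. *)
Lemma Lambda0_commutative (R : realType) (A B : Lambda R 0) : A * B = B * A.
Proof.
elim: (Lambda_polynomial A) => {A} [f|[]|k A _ IH|A A' _ IH _ IH'|A A' _ IH _ IH'] //.
- elim: (Lambda_polynomial B) => {B} [g|[]|k B _ IH|B B' _ IH _ IH'|B B' _ IH _ IH'] //.
  + by rewrite -!rmorphM mulrC.
  + by rewrite -scalerAr IH scalerAl.
  + by rewrite mulrDr mulrDl IH IH'.
  + by rewrite mulrA IH -mulrA IH' mulrA.
- by rewrite -scalerAl IH scalerAr.
- by rewrite mulrDr mulrDl IH IH'.
- by rewrite -mulrA IH' mulrA IH mulrA.
Qed.

Theorem theorem2p9 (R : realType) (s : nat) :
  exists Z : Lambda R s,
    [/\ (forall A B : Lambda R s, commutator A B = Z * lie A B),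
        (forall A : Lambda R s, lie Z A = 0 /\ commutator Z A = 0),
        (forall i j : 'I_s,
           commutator (qvar R i) (pvar R j) = Z * lie (qvar R i) (pvar R j) /\
           Z * lie (qvar R i) (pvar R j) = Z * (i == j)%:R),
        (forall star : Lambda R s -> Lambda R s,
           canonical_involution star -> Z = - star Z) &
        (forall i j : 'I_s,
           [/\ commutator (qvar R i) (qvar R j) = Z * lie (qvar R i) (qvar R j),
               Z * lie (qvar R i) (qvar R j) = 0,
               commutator (pvar R i) (pvar R j) = Z * lie (pvar R i) (pvar R j) &
               Z * lie (pvar R i) (pvar R j) = 0])].
Proof.
(* The coordinate relations are instances of these three properties, so only here does the choice of
   Z depend on [s]. *)
have [Z [ZE Zcentral Zstar]] : exists Z : Lambda R s,
    [/\ forall A B, commutator A B = Z * lie A B,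
        forall A, lie Z A = 0 /\ commutator Z A = 0 &
        forall star, canonical_involution star -> Z = - star Z].
  case: s => [|n].
    exists 0; split=> [A B|A|star [star_lin _ _ _ _ _]].
    - by rewrite mul0r /commutator Lambda0_commutative subrr.
    - by rewrite lie0l /commutator mul0r mulr0 subrr.
    - have := star_lin 1 0 0; rewrite !scale1r addr0 => /esym/(canRL (addrK _)).
      by rewrite subrr => ->; rewrite oppr0.
  (* A single canonical pair determines Z for all [A] and [B]; index [ord0] exists since [s] is
     positive. *)
  pose q : Lambda R n.+1 := qvar R ord0; pose p : Lambda R n.+1 := pvar R ord0.
  have qp : lie q p = 1 by rewrite lie_qvar_pvar eqxx.
  exists (commutator q p); split=> [A B|A|star [star_lin starM _ _ starq starp]].
  - exact: commutator_canonical.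
  - by split; [exact: lie_canonical | exact: canonical_central].
  (* The involution fixes [q] and [p] but reverses products, so it sends [q,p] to [p,q]. *)
  have starB A B : star (A - B) = star A - star B.
    by rewrite addrC -scaleN1r star_lin scaleN1r addrC.
  by rewrite /commutator starB !starM starq starp opprB.
exists Z; split=> // i j; last by rewrite !ZE lie_fvar_fvar lie_pvar_pvar mulr0.
by rewrite ZE lie_qvar_pvar.
Qed.
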